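(* Let $(\mathcal{V},\mathcal{E})$ be a connected undirected graph with incidence matrix $\mathbf{E}\in\mathbb{R}^{n\times l}$, and for a real diagonal matrix $\mathbf{W}\in\mathbb{R}^{l\times l}$ of edge weights let $L(\mathbf{W})=\mathbf{E}\mathbf{W}\mathbf{E}^T$. For any two non-empty disjoint sets $\mathcal{V}_a,\mathcal{V}_b\subset\mathcal{V}$, on the set of diagonal matrices $\mathbf{W}$ for which $L(\mathbf{W})$ is positive semi-definite with only one zero eigenvalue, $\mathbf{W}\mapsto g_{\mathrm{eff}}(L(\mathbf{W}),\mathcal{V}_a,\mathcal{V}_b)$ is a concave function of $\mathbf{W}$ and $\mathbf{W}\mapsto r_{\mathrm{eff}}(L(\mathbf{W}),\mathcal{V}_a,\mathcal{V}_b)$ is a convex function of $\mathbf{W}$.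
   Context: $(\mathcal{V},\mathcal{E})$ is a finite simple undirected graph, $n=|\mathcal{V}|$, $l=|\mathcal{E}|$; with the edges arbitrarily oriented, $\mathbf{E}\in\mathbb{R}^{n\times l}$ is the incidence matrix (column of an edge from $i$ to $j$: entry $1$ in row $i$, $-1$ in row $j$, $0$ elsewhere). $\mathbf{W}$ is the diagonal matrix of edge weights; weights may be positive or negative. $L=\mathbf{E}\mathbf{W}\mathbf{E}^T$ is the Laplacian (real symmetric with zero row sums). ''Positive semi-definite with only one zero eigenvalue'' means $L\succeq 0$ and $0$ is a simple eigenvalue. Effective resistance/conductance: for non-empty disjoint $\mathcal{V}_a,\mathcal{V}_b\subset\mathcal{V}$ put $\mathcal{V}_c=\mathcal{V}\setminus(\mathcal{V}_a\cup\mathcal{V}_b)$, $a=|\mathcal{V}_a|$, $b=|\mathcal{V}_b|$, and let $L_{xy}$ be the submatrix of $L$ with rows indexed by $\mathcal{V}_x$ and columns by $\mathcal{V}_y$. When $L_{cc}$ is nonsingular (which is automatic if $L$ is positive semi-definite with only one zero eigenvalue), let $L/L_{cc}$ be the Schur complement $$L/L_{cc}=\begin{bmatrix}L_{aa}&L_{ab}\\L_{ab}^T&L_{bb}\end{bmatrix}-\begin{bmatrix}L_{ac}\\L_{bc}\end{bmatrix}L_{cc}^{-1}\begin{bmatrix}L_{ac}^T&L_{bc}^T\end{bmatrix},$$ with $L/L_{cc}=L$ if $\mathcal{V}_c=\emptyset$. Then $g_{\mathrm{eff}}(L,\mathcal{V}_a,\mathcal{V}_b)=\mathbf{e}_{\mathcal{V}_a}^T(L/L_{cc})\mathbf{e}_{\mathcal{V}_a}$,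 where $\mathbf{e}_{\mathcal{V}_a}\in\mathbb{R}^{a+b}$ has entries $1$ on $\mathcal{V}_a$ and $0$ on $\mathcal{V}_b$, and $r_{\mathrm{eff}}(L,\mathcal{V}_a,\mathcal{V}_b)=g_{\mathrm{eff}}(L,\mathcal{V}_a,\mathcal{V}_b)^{-1}$ (with $r_{\mathrm{eff}}=\infty$ if $g_{\mathrm{eff}}=0$). *)

(* Defs.v *)
From HB Require Import structures.
From mathcomp Require Import all_boot all_order all_algebra.
From mathcomp Require Export classical_sets reals constructive_ereal.
From mathcomp Require Export interval_inference convex.

Set Implicit Arguments.
Unset Strict Implicit.
Unset Printing Implicit Defensive.

Import Order.TTheory GRing.Theory Num.Theory.

Local Open Scope ring_scope.
Local Open Scope convex_scope.

(* A simple graph on 'I_n is a symmetric irreflexive relation e.  The maps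
   s, t : 'I_l -> 'I_n list each undirected edge {s k, t k} exactly once,
   oriented from s k to t k; in particular l is the number of edges. *)
Definition oriented_edges (n l : nat) (e : rel 'I_n) (s t : 'I_l -> 'I_n) :
    Prop :=
  [/\ forall k, e (s k) (t k),
      injective (fun k => [set s k; t k]%SET)
    & forall i j, e i j -> exists k, [set s k; t k]%SET = [set i; j]%SET].

Definition is_incidence_mx (R : realType) (n l : nat) (e : rel 'I_n)
    (E : 'M[R]_(n, l)) : Prop :=
  exists s t : 'I_l -> 'I_n, oriented_edges e s t /\
    E = \matrix_(i < n, k < l)
          (if i == s k then 1 else if i == t k then -1 else 0).

Definition laplacian (R : realType) (n l : nat) (E : 'M[R]_(n, l))
    (W : 'M[R]_l) : 'M[R]_n :=
  E *m W *m E^T.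

Definition psd_mx (R : realType) (n : nat) (M : 'M[R]_n) : Prop :=
  M^T = M /\ forall x : 'cV[R]_n, 0 <= (x^T *m M *m x) 0 0.

Definition simple_eigenvalue (R : realType) (n : nat) (M : 'M[R]_n) (a : R) :
    Prop :=
  mup a (char_poly M) = 1%N.

Definition psd_one_zero (R : realType) (n : nat) (M : 'M[R]_n) : Prop :=
  psd_mx M /\ simple_eigenvalue M 0.

Definition restrict_mx (R : realType) (n : nat) (M : 'M[R]_n)
    (X Y : {set 'I_n}) : 'M[R]_(#|X|, #|Y|) :=
  mxsub (@enum_val _ (mem X)) (@enum_val _ (mem Y)) M.

(* When C is empty the subtracted product has inner dimension 0, hence is 0.
   When M_CC is singular, invmx returns M_CC itself and the value is junk. *)
Definition schur_mx (R : realType) (n : nat) (M : 'M[R]_n)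
    (A B : {set 'I_n}) : 'M[R]_(#|A| + #|B|) :=
  let C := ~: (A :|: B) in
  block_mx (restrict_mx M A A) (restrict_mx M A B)
           (restrict_mx M A B)^T (restrict_mx M B B)
  - col_mx (restrict_mx M A C) (restrict_mx M B C)
    *m invmx (restrict_mx M C C)
    *m row_mx (restrict_mx M A C)^T (restrict_mx M B C)^T.

Definition g_eff (R : realType) (n : nat) (M : 'M[R]_n)
    (A B : {set 'I_n}) : R :=
  let eA : 'cV[R]_(#|A| + #|B|) := col_mx (const_mx 1) (const_mx 0) in
  (eA^T *m schur_mx M A B *m eA) 0 0.

(* Inversion in \bar R satisfies 0^-1 = +oo. *)
Definition r_eff (R : realType) (n : nat) (M : 'M[R]_n)
    (A B : {set 'I_n}) : \bar R :=
  ((g_eff M A B)%:E^-1)%E.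

Definition concave_function (R : realType) (V : lmodType R)
    (D : set (convex_lmodType V)) (f : V -> R) : Prop :=
  convex_function D (fun x => - f x).

(* Extended-real-valued counterpart of convex_function. *)
Definition econvex_function (R : realType) (V : lmodType R)
    (D : set (convex_lmodType V)) (f : V -> \bar R) : Prop :=
  forall t : {i01 R}, {in D &, forall x y : convex_lmodType V,
    (f (x <| t |> y)
       <= t%:num%:E * f x + (1 - t%:num)%:E * f y)%E}.

Definition admissible_weights (R : realType) (n l : nat) (E : 'M[R]_(n, l)) :
    set 'M[R]_l :=
  [set W | is_diag_mx W /\ psd_one_zero (laplacian E W)]%classic.

(* Main.v *)
Require Import Defs.
From mathcomp Require Import all_boot all_order all_algebra.
From mathcomp Require Import ring lra.

Set Implicit Arguments.
Unset Strict Implicit.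
Unset Printing Implicit Defensive.

Import Order.TTheory GRing.Theory Num.Theory.

Local Open Scope ring_scope.
Local Open Scope convex_scope.

(** Why the theorem holds.  Write 1_A for the indicator vector of A and C for
    the complement of A and B.  Completing the square in the coordinates of C
    shows that, for a symmetric M with M_CC positive definite,

      g_eff M A B = min { x^T M x : x = 1 on A, x = 0 on B }

    (Dirichlet's principle: [qform_potential], [g_eff_le], [g_eff_attained]).
    The set of competitors x does not depend on M and x^T M x is linear in M,
    so g_eff is a minimum of linear functions of M, hence concave
    ([g_eff_concave]); it stays concave in W because the Laplacian is linear in
    W.  A minimiser is not constant, hence not in the kernel of M, so that
    g_eff > 0 ([g_eff_gt0]); convexity of r_eff = 1 / g_eff follows since the
    inverse is convex and decreasing on positive reals ([inv_le_comb]).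

    What remains is to handle the hypothesis that 0 is a simple eigenvalue,
    that is, a simple root of the characteristic polynomial.  The vector of
    ones is always in the kernel of a Laplacian, and for a symmetric matrix the
    algebraic multiplicity of 0 is the dimension of the kernel; so the
    hypothesis says that the kernel consists of the constant vectors
    ([psd_one_zeroP]).  In this form it is clearly preserved by convex
    combinations of positive semi-definite matrices ([psd_one_zero_conv]).
    Spectral theory is avoided: subtracting from M a rank one matrix built from
    the known kernel vector moves one eigenvalue away from 0 and leaves the
    others in place ([char_poly_deflation]), so that 0 is a simple root exactly
    when the modified matrix is invertible. *)

(** * Simplicity of the eigenvalue 0 *)

(** The rank one case of Sylvester's determinant identity: both sides are
    a times the determinant of the bordered matrix with blocks a, -u, v, 1,
    where the block -u is cleared by row operations on the left-hand side and
    by column operations on the right-hand side.  The column operations scale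
    the last column by a, whence the factor a on the left. *)
Lemma det_scalar_add_rank1 (R : comNzRingType) (n : nat) (a : R)
    (u : 'cV[R]_n) (v : 'rV[R]_n) :
  a * \det (a%:M + u *m v) = a ^+ n * (a + (v *m u) 0 0).
Proof.
pose D := block_mx a%:M (- u) v (1%:M : 'M_1).
have detD : \det D = \det (a%:M + u *m v).
  have -> : D = block_mx 1%:M (- u) 0 1%:M *m block_mx (a%:M + u *m v) 0 v 1%:M.
    by rewrite mulmx_block !mul1mx !mul0mx !mulmx1 !add0r mulNmx addrK.
  by rewrite det_mulmx det_ublock det_lblock !det1 !mul1r mulr1.
have := congr1 determinant (mulmx_block a%:M (- u) v (1%:M : 'M_1)
          1%:M u 0 a%:M).
rewrite det_mulmx -/D detD det_ublock det1 mul1r det_scalar1 !mulmx1 !mulmx0.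
rewrite !mul1mx mulNmx addr0 -scalar_mxC addrN det_lblock.
rewrite mulrC det_scalar det_mx11 => ->.
by rewrite [(_ + a%:M) 0 0]mxE [a%:M 0 0]mxE eqxx mulr1n addrC.
Qed.

(** As M u = 0, one has (X - M) (X + u v) = X (X - M + u v); take determinants
    and evaluate that of X + u v by [det_scalar_add_rank1].  The common factor
    X^n then cancels.  On spectra: one eigenvalue 0 of M becomes - v u. *)
Lemma char_poly_deflation (F : idomainType) (n : nat) (M : 'M[F]_n)
    (u : 'cV[F]_n) (v : 'rV[F]_n) (Mu0 : M *m u = 0) :
  char_poly M * ('X + ((v *m u) 0 0)%:P) = 'X * char_poly (M - u *m v).
Proof.
have Xn0 : 'X ^+ n != 0 :> {poly F} by rewrite expf_neq0 ?polyX_eq0.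
apply: (mulfI Xn0).
set U := map_mx polyC u; set V := map_mx polyC v.
have vuE : ((v *m u) 0 0)%:P = (V *m U) 0 0 by rewrite /V /U -map_mxM [RHS]mxE.
rewrite vuE mulrCA -det_scalar_add_rank1 mulrCA [RHS]mulrCA; congr (_ * _).
rewrite -det_mulmx -detZ /char_poly_mx; congr (\det _).
have MU0 : map_mx polyC M *m U = 0 by rewrite -map_mxM Mu0 map_mx0.
rewrite map_mxB map_mxM -/U -/V mulmxDr !mulmxBl !mulmxA MU0 mul0mx subr0.
rewrite mul_scalar_mx scalar_mxC !mul_scalar_mx -scalemxAl -scalerBr.
by rewrite -scalerDr opprB addrA addrAC.
Qed.

Lemma mulmx_mx11r (R : comNzRingType) (n : nat) (u : 'cV[R]_n) (a : 'M[R]_1) :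
  u *m a = a 0 0 *: u.
Proof. by rewrite {1}[a]mx11_scalar mul_mx_scalar. Qed.

(** A solution of M x = u would give v u = v M x = 0, so u does not start a
    longer Jordan chain; the multiplicity of 0 can then exceed 1 only through
    kernel vectors outside the line of u.  Both conditions are compared with the
    invertibility of the deflated matrix N = M - u v. *)
Lemma simple_zeroP (R : realType) (n : nat) (M : 'M[R]_n)
    (u : 'cV[R]_n) (v : 'rV[R]_n) :
    M *m u = 0 -> v *m M = 0 -> (v *m u) 0 0 != 0 ->
  simple_eigenvalue M 0 <->
  forall x : 'cV_n, M *m x = 0 -> exists c, x = c *: u.
Proof.
move=> Mu0 vM0 vu0; pose N := M - u *m v.
have NE (x : 'cV_n) : N *m x = M *m x - (v *m x) 0 0 *: u.
  by rewrite /N mulmxBl -mulmxA mulmx_mx11r.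
have simpleE : simple_eigenvalue M 0 <-> N \in unitmx.
  have nrX : ~~ root ('X + ((v *m u) 0 0)%:P) 0.
    by rewrite rootE hornerD hornerX hornerC add0r.
  rewrite /simple_eigenvalue -(mupMl _ nrX) (char_poly_deflation v Mu0) -/N.
  have q0 : char_poly N != 0 by rewrite monic_neq0 ?char_poly_monic.
  have mupX : mup 0 ('X : {poly R}) = 1%N.
    by have := mup_XsubCX 1 (0 : R) 0; rewrite eqxx expr1 subr0.
  rewrite mupM ?polyX_eq0 // mupX add1n.
  have -> : (N \in unitmx) = ~~ root (char_poly N) 0.
    rewrite rootE horner_coef0 char_poly_det mulf_eq0 signr_eq0 /=.
    by rewrite unitmxE unitfE.
  rewrite -dvdp_XsubCl XsubC_dvd // lt0n negbK.
  by split=> [[->] | /eqP ->].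
rewrite simpleE; split=> [Nunit x Mx0 | kerM].
  (* This c makes x - c u orthogonal to v, so that N kills it. *)
  exists ((v *m x) 0 0 / (v *m u) 0 0); set c := _ / _.
  apply/eqP; rewrite -subr_eq0; apply/eqP.
  rewrite -[LHS](mulKmx Nunit) mulmxBr -scalemxAr !NE Mx0 Mu0 !sub0r scalerN.
  by rewrite opprK scalerA divfK // addNr mulmx0.
rewrite unitmxE unitfE -det_tr; apply/negP => /det0P[w w0 wN0].
have Nw0 : N *m w^T = 0 by apply: trmx_inj; rewrite trmx_mul trmxK wN0 trmx0.
have vw0 : (v *m w^T) 0 0 = 0.
  have : (v *m (N *m w^T)) 0 0 = 0 by rewrite Nw0 mulmx0 mxE.
  rewrite NE mulmxBr mulmxA vM0 mul0mx sub0r -scalemxAr mxE [X in - X]mxE.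
  by move/eqP; rewrite oppr_eq0 mulf_eq0 (negPf vu0) orbF => /eqP.
have Mw0 : M *m w^T = 0 by move: Nw0; rewrite NE vw0 scale0r subr0.
have [c wE] := kerM _ Mw0.
move: vw0; rewrite wE -scalemxAr mxE => /eqP.
rewrite mulf_eq0 (negPf vu0) orbF => /eqP c0.
by case/eqP: w0; apply: trmx_inj; rewrite wE c0 scale0r trmx0.
Qed.

(** * Quadratic forms *)

Definition qform (R : realType) (n : nat) (M : 'M[R]_n) (x : 'cV[R]_n) : R :=
  (x^T *m M *m x) 0 0.

Lemma bilin_sym (R : realType) (n : nat) (M : 'M[R]_n) (x y : 'cV[R]_n) :
  M^T = M -> x^T *m M *m y = (y^T *m M *m x)^T.
Proof. by move=> Ms; rewrite !trmx_mul trmxK Ms mulmxA. Qed.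

Lemma qformD (R : realType) (n : nat) (M : 'M[R]_n) (x y : 'cV[R]_n) :
  M^T = M -> qform M (x + y) = qform M x + 2 * (y^T *m M *m x) 0 0 + qform M y.
Proof.
move=> Ms; rewrite /qform [(x + y)^T]linearD /= !mulmxDl !mulmxDr.
by rewrite (bilin_sym x y Ms) !mxE; ring.
Qed.

Lemma qform_comb (R : realType) (n : nat) (M N : 'M[R]_n) (a b : R)
    (x : 'cV[R]_n) :
  qform (a *: M + b *: N) x = a * qform M x + b * qform N x.
Proof.
rewrite /qform mulmxDr mulmxDl -!scalemxAr -!scalemxAl.
by rewrite mxE [X in X + _]mxE [X in _ + X]mxE.
Qed.

Lemma sqnorm_eq0 (R : realType) (n : nat) (x : 'cV[R]_n) :
  (x^T *m x) 0 0 = 0 -> x = 0.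
Proof.
rewrite mxE => /eqP; rewrite psumr_eq0 => [|i _]; last by rewrite mxE sqr_ge0.
move=> /allP x0; apply/matrixP => i j; rewrite mxE (ord1 j).
by have := x0 i (mem_index_enum _); rewrite mxE mulf_eq0 orbb => /eqP.
Qed.

(** A zero of a nonnegative quadratic form is a minimum, where the gradient
    2 M x vanishes.  Concretely, the form is tested at x + s y with y = M x. *)
Lemma psd_qform_eq0 (R : realType) (n : nat) (M : 'M[R]_n) (x : 'cV[R]_n) :
  psd_mx M -> qform M x = 0 -> M *m x = 0.
Proof.
move=> [Ms Mge0] x0; apply: sqnorm_eq0.
set y := M *m x; set b : R := (y^T *m y) 0 0.
have yE : (y^T *m M *m x) 0 0 = b by rewrite -mulmxA.
have b0 : 0 <= b.
  by rewrite /b mxE sumr_ge0 // => i _; rewrite mxE sqr_ge0.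
have c0 : 0 <= qform M y := Mge0 y.
(* The minimiser -b / qform M y would be undefined for qform M y = 0; adding
   1 to the denominator still gives a negative value unless b = 0. *)
pose s := - (b / (qform M y + 1)).
have := Mge0 (x + s *: y); rewrite -/(qform _ _) qformD // x0 add0r.
have -> : qform M (s *: y) = s ^+ 2 * qform M y.
  rewrite /qform [(s *: y)^T]linearZ /= -!scalemxAl -scalemxAr !scalerA mxE.
  ring.
rewrite [(s *: y)^T]linearZ /= -!scalemxAl mxE yE.
have d0 : 0 < qform M y + 1 by lra.
have sE : s * (qform M y + 1) = - b by rewrite /s mulNr divfK // gt_eqF.
have -> : 2 * (s * b) + s ^+ 2 * qform M y = s * (b - s) by nra.
move=> s_bs; case: (ltgtP b 0) => [|b_gt0|//]; first by lra.
have s_lt0 : s < 0 by nra.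
by nra.
Qed.

(** * Laplacians *)

(** The two entries 1 and -1 of a column sit in different rows because the
    graph has no loops: otherwise the column would hold a single 1. *)
Lemma incidence_mx_ones (R : realType) (n l : nat) (e : rel 'I_n)
    (E : 'M[R]_(n, l)) :
  irreflexive e -> is_incidence_mx e E -> E^T *m const_mx 1 = 0 :> 'cV_l.
Proof.
move=> e_irr [s [t [[est _ _] ->]]]; apply/matrixP => k j; rewrite !mxE.
have ts : t k != s k.
  by apply/eqP => ts; have := est k; rewrite ts e_irr.
rewrite (bigD1 (s k)) //= (bigD1 (t k)) //= !mxE !eqxx (negPf ts) big1.
  by rewrite !mulr1 addr0 subrr.
by move=> i /andP[/negPf is_ /negPf it]; rewrite !mxE is_ it mul0r.
Qed.

Lemma laplacian_ones (R : realType) (n l : nat) (e : rel 'I_n)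
    (E : 'M[R]_(n, l)) (W : 'M[R]_l) :
  irreflexive e -> is_incidence_mx e E ->
  laplacian E W *m const_mx 1 = 0 :> 'cV_n.
Proof.
by move=> ei hE; rewrite /laplacian -mulmxA (incidence_mx_ones ei hE) mulmx0.
Qed.

Lemma laplacian_comb (R : realType) (n l : nat) (E : 'M[R]_(n, l)) (a b : R)
    (W Z : 'M[R]_l) :
  laplacian E (a *: W + b *: Z) = a *: laplacian E W + b *: laplacian E Z.
Proof. by rewrite /laplacian mulmxDr mulmxDl -!scalemxAr -!scalemxAl. Qed.

(** Instance of [simple_zeroP] for the vector of ones, which is a kernel vector
    on both sides since M is symmetric; the index i0 witnesses n > 0, which
    makes its squared norm n nonzero. *)
Lemma psd_one_zeroP (R : realType) (n : nat) (M : 'M[R]_n) (i0 : 'I_n) :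
    M *m const_mx 1 = 0 :> 'cV_n ->
  psd_one_zero M <->
  psd_mx M /\ forall x : 'cV_n, M *m x = 0 -> exists c, x = const_mx c.
Proof.
move=> M1; pose u : 'cV[R]_n := const_mx 1.
have scaleu c : c *: u = const_mx c.
  by apply/matrixP => i j; rewrite !mxE mulr1.
have kerE : (forall x : 'cV_n, M *m x = 0 -> exists c, x = c *: u) <->
            (forall x : 'cV_n, M *m x = 0 -> exists c, x = const_mx c).
  by split=> ker x /ker[c ->]; exists c.
(* Symmetry, which provides the left kernel vector, is part of [psd_mx]. *)
rewrite /psd_one_zero -kerE.
suff simpleE : M^T = M ->
    simple_eigenvalue M 0 <->
    forall x : 'cV_n, M *m x = 0 -> exists c, x = c *: u.
  by split=> -[Mpsd]; have /simpleE[] := Mpsd.1; split; auto.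
move=> Ms; apply: (simple_zeroP (v := u^T)) => //.
  by apply: trmx_inj; rewrite trmx_mul trmxK Ms trmx0.
have -> : (u^T *m u) 0 0 = n%:R.
  rewrite mxE (eq_bigr (fun=> 1)) => [|i _]; last by rewrite !mxE mulr1.
  by rewrite sumr_const card_ord.
by rewrite pnatr_eq0 -lt0n (leq_ltn_trans _ (ltn_ord i0)).
Qed.

(** A kernel vector of the combination annihilates both quadratic forms, at
    least one of which has a positive weight, so it lies in the kernel of the
    corresponding matrix. *)
Lemma psd_one_zero_conv (R : realType) (n : nat) (M N : 'M[R]_n) (i0 : 'I_n)
    (a b : R) :
    M *m const_mx 1 = 0 :> 'cV_n -> N *m const_mx 1 = 0 :> 'cV_n ->
    0 <= a -> 0 <= b -> a + b = 1 ->
  psd_one_zero M -> psd_one_zero N -> psd_one_zero (a *: M + b *: N).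
Proof.
move=> M1 N1 a0 b0 ab.
move=> /(psd_one_zeroP i0 M1)[Mpsd kerM] /(psd_one_zeroP i0 N1)[Npsd kerN].
have qM x : 0 <= qform M x := Mpsd.2 x.
have qN x : 0 <= qform N x := Npsd.2 x.
apply/(psd_one_zeroP i0).
  by rewrite mulmxDl -!scalemxAl M1 N1 !scaler0 addr0.
split; first split.
- by rewrite linearD !linearZ /= Mpsd.1 Npsd.1.
- by move=> x; rewrite -/(qform _ x) qform_comb addr_ge0 ?mulr_ge0.
move=> x x0; have : qform (a *: M + b *: N) x = 0.
  by rewrite /qform -mulmxA x0 mulmx0 mxE.
rewrite qform_comb => /eqP; rewrite paddr_eq0 ?mulr_ge0 // !mulf_eq0.
case/andP=> /orP[/eqP a_eq0|/eqP /(psd_qform_eq0 Mpsd)/kerM //].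
have -> : b = 1 by rewrite -ab a_eq0 add0r.
by rewrite oner_eq0 => /eqP /(psd_qform_eq0 Npsd)/kerN.
Qed.

(** * Dirichlet's principle for the effective conductance *)

(** Extension by zero from X to all vertices, as a matrix.  It turns passing to
    submatrices into matrix products, see [restrict_mxE]. *)
Definition incl_mx (R : realType) (n : nat) (X : {set 'I_n}) :
    'M[R]_(n, #|X|) :=
  colsub (@enum_val _ (mem X)) 1%:M.

Lemma restrict_mxE (R : realType) (n : nat) (M : 'M[R]_n) (X Y : {set 'I_n}) :
  restrict_mx M X Y = (incl_mx R X)^T *m M *m incl_mx R Y.
Proof.
have -> : (incl_mx R X)^T = rowsub (@enum_val _ (mem X)) 1%:M.
  by rewrite /incl_mx trmx_mxsub trmx1.
by rewrite mulmx_colsub mulmx1 mul_rowsub_mx mul1mx -mxsub_comp.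
Qed.

Lemma incl_mx_enum_val (R : realType) (n : nat) (X : {set 'I_n})
    (y : 'cV[R]_#|X|) (j : 'I_#|X|) :
  (incl_mx R X *m y) (enum_val j) 0 = y j 0.
Proof.
rewrite mxE (bigD1 j) //= !mxE eqxx mul1r big1 ?addr0 // => k kj.
by rewrite !mxE (inj_eq enum_val_inj) eq_sym (negPf kj) mul0r.
Qed.

Lemma incl_mx_out (R : realType) (n : nat) (X : {set 'I_n}) (y : 'cV[R]_#|X|)
    (i : 'I_n) :
  i \notin X -> (incl_mx R X *m y) i 0 = 0.
Proof.
move=> iX; rewrite mxE big1 // => k _; rewrite !mxE; case: eqP => [ik|_].
  by rewrite ik enum_valP in iX.
by rewrite mul0r.
Qed.

Section Potentials.

Context (R : realType) (n : nat) (A B : {set 'I_n}).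

Let C := ~: (A :|: B).

(** The vectors equal to 1 on A and 0 on B, parametrized by their values y on
    the other vertices. *)
Definition potential (y : 'cV[R]_#|C|) : 'cV[R]_n :=
  incl_mx R A *m const_mx 1 + incl_mx R C *m y.

Lemma potential_A y i : i \in A -> potential y i 0 = 1.
Proof.
move=> iA; rewrite mxE [X in _ + X]incl_mx_out ?addr0; last by rewrite !inE iA.
by rewrite -(enum_rankK_in iA iA) incl_mx_enum_val mxE.
Qed.

Lemma potential_B y i : [disjoint A & B] -> i \in B -> potential y i 0 = 0.
Proof.
move=> dAB iB; rewrite mxE !incl_mx_out ?addr0 //.
  by rewrite !inE iB orbT.
by rewrite (disjointFl dAB iB).
Qed.

(** The vector e_A vanishes on B, so only the blocks AA, AC and CC of M enter;
    the first term is then the form at the indicator u of A. *)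
Lemma g_effE (M : 'M[R]_n) (u := incl_mx R A *m const_mx 1 : 'cV_n)
    (w := (incl_mx R C)^T *m M *m u) :
  M^T = M ->
  g_eff M A B = qform M u - (w^T *m invmx (restrict_mx M C C) *m w) 0 0.
Proof.
move=> Ms; rewrite /g_eff /schur_mx -/C.
have -> : const_mx 0 = 0 :> 'cV[R]_#|B| by apply/matrixP=> i j; rewrite !mxE.
rewrite mulmxBr mulmxBl tr_col_mx trmx0 mul_row_block !mul0mx !addr0.
rewrite mul_row_col mulmx0 addr0 !mulmxA mul_row_col mul0mx addr0 -!mulmxA.
rewrite mul_row_col mulmx0 addr0 mxE [X in _ + X]mxE.
by rewrite /qform /w /u !restrict_mxE !trmx_mul !trmxK Ms !mulmxA.
Qed.

(** Completing the square in y. *)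
Lemma qform_potential (M : 'M[R]_n) (y : 'cV[R]_#|C|)
    (S := restrict_mx M C C)
    (w := (incl_mx R C)^T *m M *m (incl_mx R A *m const_mx 1) : 'cV_#|C|) :
    M^T = M -> S \in unitmx ->
  qform M (potential y) = g_eff M A B + qform S (y + invmx S *m w).
Proof.
move=> Ms Su; rewrite g_effE // -/w -/S.
have Ss : S^T = S by rewrite /S restrict_mxE !trmx_mul trmxK Ms mulmxA.
rewrite /potential [y + _]addrC !qformD //.
have -> : qform S (invmx S *m w) = (w^T *m invmx S *m w) 0 0.
  by rewrite /qform trmx_mul trmx_inv Ss -!mulmxA mulKVmx.
have -> : qform M (incl_mx R C *m y) = qform S y.
  by rewrite /qform /S restrict_mxE trmx_mul !mulmxA.
have -> : y^T *m S *m (invmx S *m w) = y^T *m w by rewrite -mulmxA mulKVmx.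
rewrite /w trmx_mul !mulmxA; ring.
Qed.

Context (M : 'M[R]_n) (i0 : 'I_n).
Context (M1 : M *m const_mx 1 = 0 :> 'cV_n) (Mpsd1 : psd_one_zero M).
Context (i0A : i0 \in A).

(** A kernel vector of M_CC extended by zero is a null vector of the form of M,
    hence constant, hence zero because it vanishes at the vertex i0 of A. *)
Lemma restrict_mx_unit : restrict_mx M C C \in unitmx.
Proof.
have [Mpsd kerM] := (psd_one_zeroP i0 M1).1 Mpsd1.
rewrite unitmxE unitfE; apply/negP => /det0P[w /negP w0 wS]; apply: w0.
have : qform M (incl_mx R C *m w^T) = 0.
  rewrite /qform trmx_mul trmxK.
  have -> : w *m (incl_mx R C)^T *m M *m (incl_mx R C *m w^T)
            = w *m restrict_mx M C C *m w^T by rewrite restrict_mxE !mulmxA.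
  by rewrite wS mul0mx mxE.
move=> /(psd_qform_eq0 Mpsd) /kerM[c xc].
have c0 : c = 0.
  have := congr1 (fun z : 'cV_n => z i0 0) xc.
  by rewrite /= incl_mx_out ?mxE // !inE i0A.
apply/eqP/matrixP => i j; rewrite (ord1 i) -[w]trmxK [LHS]mxE.
by rewrite -incl_mx_enum_val xc c0 !mxE.
Qed.

Lemma g_eff_le y : g_eff M A B <= qform M (potential y).
Proof.
have [[Ms Mge0] _] := Mpsd1.
rewrite qform_potential ?restrict_mx_unit // lerDl.
set z := _ + _.
have -> : qform (restrict_mx M C C) z = qform M (incl_mx R C *m z).
  by rewrite /qform restrict_mxE trmx_mul !mulmxA.
exact: Mge0.
Qed.

(** The minimiser is the harmonic extension y = - M_CC^-1 M_CA 1, which makes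
    the completed square vanish. *)
Lemma g_eff_attained : exists y, g_eff M A B = qform M (potential y).
Proof.
have [[Ms Mge0] _] := Mpsd1.
exists (- (invmx (restrict_mx M C C)
           *m ((incl_mx R C)^T *m M *m (incl_mx R A *m const_mx 1)))).
rewrite qform_potential ?restrict_mx_unit // addNr.
by rewrite /qform mulmx0 mxE addr0.
Qed.

(** Otherwise a potential would lie in the kernel of M and be constant, but it
    takes both values 1 and 0. *)
Lemma g_eff_gt0 (j0 : 'I_n) : [disjoint A & B] -> j0 \in B -> 0 < g_eff M A B.
Proof.
move=> dAB j0B; have [y ->] := g_eff_attained.
have [Mpsd kerM] := (psd_one_zeroP i0 M1).1 Mpsd1.
rewrite lt_neqAle [_ <= _](Mpsd.2 _) andbT eq_sym; apply/eqP.
move=> /(psd_qform_eq0 Mpsd) /kerM[c pc].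
have := potential_A y i0A; have := potential_B y dAB j0B.
by rewrite pc !mxE => -> /eqP; rewrite eq_sym oner_eq0.
Qed.

End Potentials.

(** * Concavity of the conductance and convexity of the resistance *)

(** The minimiser for the combination competes in the problems for M and N. *)
Lemma g_eff_concave (R : realType) (n : nat) (M N : 'M[R]_n)
    (A B : {set 'I_n}) (i0 : 'I_n) (a b : R) :
    i0 \in A ->
    M *m const_mx 1 = 0 :> 'cV_n -> N *m const_mx 1 = 0 :> 'cV_n ->
    psd_one_zero M -> psd_one_zero N ->
    0 <= a -> 0 <= b -> a + b = 1 ->
  a * g_eff M A B + b * g_eff N A B <= g_eff (a *: M + b *: N) A B.
Proof.
move=> i0A M1 N1 Mpsd Npsd a0 b0 ab.
have K1 : (a *: M + b *: N) *m const_mx 1 = 0 :> 'cV_n.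
  by rewrite mulmxDl -!scalemxAl M1 N1 !scaler0 addr0.
have Kpsd := psd_one_zero_conv i0 M1 N1 a0 b0 ab Mpsd Npsd.
have [y ->] := g_eff_attained B K1 Kpsd i0A.
by rewrite qform_comb lerD // ler_wpM2l // (g_eff_le _ _ i0A).
Qed.

(** The graph of x |-> 1/x lies above its tangent at k; average the tangent
    bounds at g and h. *)
Lemma inv_le_comb (R : realFieldType) (g h k a b : R) :
    0 < g -> 0 < h -> 0 < k -> 0 <= a -> 0 <= b -> a + b = 1 ->
  a * g + b * h <= k -> k^-1 <= a * g^-1 + b * h^-1.
Proof.
move=> g0 h0 k0 a0 b0 ab le_k.
have tangent x : 0 < x -> 2 * k^-1 - k^-1 ^+ 2 * x <= x^-1.
  move=> x0; rewrite -subr_ge0.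
  have -> : x^-1 - (2 * k^-1 - k^-1 ^+ 2 * x) = x * (x^-1 - k^-1) ^+ 2.
    by field; rewrite !gt_eqF.
  by rewrite mulr_ge0 ?sqr_ge0 ?ltW.
have ga := ler_wpM2l a0 (tangent g g0).
have hb := ler_wpM2l b0 (tangent h h0).
have := ler_wpM2l (sqr_ge0 k^-1) le_k.
have -> : k^-1 ^+ 2 * k = k^-1 by field; rewrite gt_eqF.
nra.
Qed.

Theorem theorem5 (R : realType) (n l : nat) (e : rel 'I_n)
    (e_sym : symmetric e) (e_irr : irreflexive e)
    (e_conn : forall i j : 'I_n, connect e i j)
    (E : 'M[R]_(n, l)) (hE : is_incidence_mx e E)
    (A B : {set 'I_n}) (hA : A != set0) (hB : B != set0)
    (hAB : [disjoint A & B]) :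
  [/\ convex_set (admissible_weights E),
      concave_function (admissible_weights E)
        (fun W => g_eff (laplacian E W) A B)
    & econvex_function (admissible_weights E)
        (fun W => r_eff (laplacian E W) A B)].
Proof.
have [i0 i0A] := set0Pn _ hA; have [j0 j0B] := set0Pn _ hB.
have L1 W := laplacian_ones W e_irr hE.
have t0 (t : {i01 R}) : 0 <= t%:num by [].
have t1 (t : {i01 R}) : 0 <= 1 - t%:num by rewrite subr_ge0.
have tt (t : {i01 R}) : t%:num + (1 - t%:num) = 1 by rewrite addrC subrK.
have convE (t : {i01 R}) (W Z : convex_lmodType 'M[R]_l) :
  W <| t |> Z = t%:num *: (W : 'M_l) + (1 - t%:num) *: (Z : 'M_l) by [].
have Lconv (t : {i01 R}) (W Z : convex_lmodType 'M[R]_l) :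
    laplacian E (W <| t |> Z)
    = t%:num *: laplacian E W + (1 - t%:num) *: laplacian E Z.
  exact: laplacian_comb.
have adm_conv : convex_set (admissible_weights E).
  move=> W Z t /set_mem[Wd Wp] /set_mem[Zd Zp]; apply/mem_set; split.
    apply/is_diag_mxP => i j ij; rewrite convE !mxE.
    by rewrite (is_diag_mxP Wd) // (is_diag_mxP Zd) // !mulr0 addr0.
  by rewrite Lconv; apply: psd_one_zero_conv.
have g_conc (t : {i01 R}) (W Z : convex_lmodType 'M[R]_l) :
    W \in admissible_weights E -> Z \in admissible_weights E ->
    t%:num * g_eff (laplacian E W) A B
      + (1 - t%:num) * g_eff (laplacian E Z) A B
    <= g_eff (laplacian E (W <| t |> Z)) A B.
  by move=> /set_mem[_ Wp] /set_mem[_ Zp]; rewrite Lconv (g_eff_concave B i0A).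
have g_pos (W : convex_lmodType 'M[R]_l) :
    W \in admissible_weights E -> 0 < g_eff (laplacian E W) A B.
  by move=> /set_mem[_ Wp]; apply: (g_eff_gt0 (L1 W) Wp i0A hAB j0B).
split=> //.
- move=> t W Z Wadm Zadm; rewrite convRE !mulrN -opprD lerN2.
  exact: g_conc.
move=> t W Z Wadm Zadm; rewrite /r_eff !inver !gt_eqF ?g_pos //.
  by rewrite -!EFinM -EFinD lee_fin inv_le_comb ?g_pos ?adm_conv ?g_conc.
exact: adm_conv.
Qed.
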